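(* Let $E$ be a symmetric operator defined on a dense domain $\mathcal D$ of a Hilbert space $\mathcal H$. Let $\mathbf d=\{d_i\}_{i\in\mathbb N}$ and $\boldsymbol\lambda=\{\lambda_i\}_{i\in\mathbb N}$ be two nondecreasing unbounded sequences of real numbers satisfying \[ \sum_{i=1}^n\lambda_i\le\sum_{i=1}^n d_i\qquad\text{for all }n\in\mathbb N. \] If there exists an orthonormal sequence $\{f_i\}_{i\in\mathbb N}\subset\mathcal D$ such that $\langle Ef_i,f_i\rangle=\lambda_i$ for all $i\in\mathbb N$, then there exists an orthonormal sequence $\{e_i\}_{i\in\mathbb N}$ contained in the (algebraic) linear span of $\{f_i\}_{i\in\mathbb N}$ such that $\overline{\operatorname{span}}\{e_i\}_{i\in\mathbb N}=\overline{\operatorname{span}}\{f_i\}_{i\in\mathbb N}$ and $\langle Ee_i,e_i\rangle=d_i$ for all $i\in\mathbb N$.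
   Context: A linear operator $E$ on a dense domain $\mathcal D\subset\mathcal H$ is symmetric if $\langle Ef,g\rangle=\langle f,Eg\rangle$ for all $f,g\in\mathcal D$. $\overline{\operatorname{span}}$ denotes the closed linear span; the linear span means finite linear combinations. *)

(* Defs.v *)
From mathcomp Require Import all_boot all_order all_algebra.
From mathcomp Require Import reals complex.
Set Implicit Arguments. Unset Strict Implicit. Unset Printing Implicit Defensive.
Import Order.TTheory GRing.Theory Num.Theory.
Local Open Scope ring_scope.

Section Hilbert.
Variables (R : realType) (H : lmodType R[i]) (ip : H -> H -> R[i]).

Definition hnorm (x : H) : R := Num.sqrt (complex.Re (ip x x)).

Record hilbert_space : Prop := {
  ip_linl : forall (a : R[i]) (x y z : H), ip (a *: x + y) z = a * ip x z + ip y z;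
  ip_herm : forall x y : H, ip x y = (ip y x)^*;
  ip_pos  : forall x : H, 0 <= ip x x;
  ip_def  : forall x : H, ip x x = 0 -> x = 0;
  ip_complete : forall u : nat -> H,
    (forall eps : R, 0 < eps -> exists N, forall m n, (N <= m)%N -> (N <= n)%N ->
        hnorm (u m - u n) < eps) ->
    exists l : H, forall eps : R, 0 < eps -> exists N, forall n, (N <= n)%N ->
        hnorm (u n - l) < eps }.

Definition hclosure (A : H -> Prop) : H -> Prop :=
  fun h => forall eps : R, 0 < eps -> exists g, A g /\ hnorm (h - g) < eps.

Definition lin_span (f : nat -> H) : H -> Prop :=
  fun x => exists (n : nat) (c : nat -> R[i]), x = \sum_(k < n) c k *: f k.

Definition orthonormal_seq (f : nat -> H) : Prop :=
  forall i j : nat, ip (f i) (f j) = (i == j)%:R.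

Definition linear_subspace (D : H -> Prop) : Prop :=
  D 0 /\ forall (a : R[i]) x y, D x -> D y -> D (a *: x + y).

Definition dense_in (D : H -> Prop) : Prop := forall h, hclosure D h.

(* E : D -> H linear (E is given as a function on H; only its values on D matter) *)
Definition linear_on (D : H -> Prop) (E : H -> H) : Prop :=
  forall (a : R[i]) x y, D x -> D y -> E (a *: x + y) = a *: E x + E y.

Definition symmetric_on (D : H -> Prop) (E : H -> H) : Prop :=
  forall f g, D f -> D g -> ip (E f) g = ip f (E g).

End Hilbert.

Definition nondecreasing_seq (R : realType) (u : nat -> R) : Prop :=
  forall i j : nat, (i <= j)%N -> u i <= u j.

Definition unbounded_seq (R : realType) (u : nat -> R) : Prop :=
  ~ (exists M : R, forall i, `|u i| <= M).

(* Main.v *)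
Require Import Defs.
From mathcomp Require Import all_boot all_order all_algebra.
From mathcomp Require Import boolp reals complex.
From mathcomp Require Import ring lra zify.
Set Implicit Arguments. Unset Strict Implicit. Unset Printing Implicit Defensive.
Import Order.TTheory GRing.Theory Num.Theory.
Local Open Scope complex_scope.
Local Open Scope ring_scope.

(** The vectors [e_p] are produced one at a time by rotations in coordinate
    planes.  At stage [p] there is an orthonormal sequence [G] with diagonal
    values [a], such that [a_r = d_r] for [r < p] and the excesses
    [sum_(k < n) (d_k - a_k)] are all nonnegative.  Put [s = d_p - a_p].  Rotating
    [G_p] against some [G_q], [q > p], gives [e_p] of value [d_p] and leaves a
    vector of value [a_p + a_q - d_p] at position [q]; the excesses stay
    nonnegative as soon as those of index in [p+1, q] are at least [s].
    - If all excesses beyond [p] are at least [s], [q] is taken so far that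
      only half of the squared mass of [G_p] is left outside [e_p].
    - Otherwise [q] is the first place where the excess falls below [s]; then
      [a_q > d_q], and the fraction left is at most [s / (s + d_q - d_p)].
    The part of [f_j] outside the span of the [e_p] already built always lies at
    a single position, which runs through [j, q_j, q_(q_j), ...].  On a run of
    steps of the second kind [s] decreases while [d] tends to infinity, so the
    squared norm of this part is again halved after finitely many steps: it
    tends to [0], and each [f_j] is in the closed span of the [e_p]. *)

(** * Diagonal values: transfers and partial-sum excesses *)

Section Transfer.
Variables (R : realType) (d : nat -> R).
Hypothesis d_mono : nondecreasing_seq d.

Definition to_infty (u : nat -> R) :=
  forall M, exists K, forall k, (K <= k)%N -> M <= u k.

Definition excess (a : nat -> R) n := \sum_(k < n) (d k - a k).

(** Effect of one rotation on the diagonal. The indicators make the change of each excess a direct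
    sum. *)
Definition transfer (a : nat -> R) p q k : R :=
  a k + (d p - a p) * ((k == p)%:R - (k == q)%:R).

Definition admissible p (a : nat -> R) :=
  [/\ forall r, (r < p)%N -> a r = d r, forall n, 0 <= excess a n & to_infty a].

(** The last inequality is [phi <= s / (s + (d q - d p))] for [s = d p - a p], cleared of its
    denominator. *)
Definition contracting p (a : nat -> R) q (phi : R) :=
  phi <= 1 / 2 \/
  [/\ 0 < d p - a p, excess a q.+1 < d p - a p
    & phi * (d p - a p + (d q - d p)) <= d p - a p].

Lemma to_infty_mono u : nondecreasing_seq u -> unbounded_seq u -> to_infty u.
Proof.
move=> um ub M; apply: contrapT => nK; apply: ub.
(* Unboundedness concerns absolute values: [u 0] supplies the lower bound. *)
exists (`|M| + `|u 0%N|) => i.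
have iM : u i <= M.
  rewrite leNgt; apply/negP => Mi; apply: nK; exists i => k ik.
  exact: le_trans (ltW Mi) (um _ _ ik).
have i0 := um 0%N i isT.
have := ler_norm M; have := ler_norm (- u 0%N); rewrite normrN.
have := normr_ge0 M; have := normr_ge0 (u 0%N) => *.
by rewrite ler_norml; apply/andP; split; lra.
Qed.

Lemma sum_indic n p : \sum_(k < n) ((k : nat) == p)%:R = (p < n)%:R :> R.
Proof.
elim: n => [|n IH]; first by rewrite big_ord0.
by rewrite big_ord_recr /= IH -natrD; congr (_%:R); lia.
Qed.

Lemma excess_transfer a p q n :
  excess (transfer a p q) n =
  excess a n - (d p - a p) * ((p < n)%:R - (q < n)%:R).
Proof.
rewrite /excess /transfer -!sum_indic -sumrB mulr_sumr -sumrB.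
by apply: eq_bigr => k _; ring.
Qed.

Lemma excess_stage p a : admissible p a -> excess a p.+1 = d p - a p.
Proof.
case=> ar _ _; rewrite /excess big_ord_recr /= big1 ?add0r // => k _.
by rewrite ar ?subrr.
Qed.

(** The transfer lowers the excess by [d p - a p] exactly at the indices in [p+1..q] and leaves the
    others alone. *)
Lemma transfer_admissible p a q : admissible p a -> (p < q)%N ->
  (forall n, (p < n <= q)%N -> d p - a p <= excess a n) ->
  admissible p.+1 (transfer a p q).
Proof.
move=> [ar an ai] pq H; split.
- move=> r; rewrite ltnS leq_eqVlt /transfer => /orP[/eqP->|rp].
    by rewrite eqxx (ltn_eqF pq) /=; ring.
  by rewrite (ltn_eqF rp) (ltn_eqF (ltn_trans rp pq)) subrr mulr0 addr0 ar.
- move=> n; rewrite excess_transfer.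
  case: (ltnP p n) => pn; case: (ltnP q n) => qn /=.
  + by rewrite subrr mulr0 subr0.
  + by rewrite subr0 mulr1 subr_ge0 H // pn.
  + by exfalso; lia.
  + by rewrite subrr mulr0 subr0.
- move=> M; have [K HK] := ai M; exists (maxn K q.+1) => k.
  rewrite geq_max => /andP[Kk qk]; rewrite /transfer.
  rewrite !gtn_eqF ?(ltn_trans pq) // subrr mulr0 addr0; exact: HK.
Qed.

(** Keeps the bound on [excess a q.+1] in [contracting] alive until stage [q], where that excess is
    the new [s]. *)
Lemma excess_transfer_le p a q n : admissible p a -> (p < q)%N ->
  excess (transfer a p q) n <= excess a n.
Proof.
move=> ad pq; rewrite excess_transfer gerBl mulr_ge0 //.
  by rewrite -excess_stage //; case: ad.
by rewrite subr_ge0 ler_nat; lia.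
Qed.

Lemma transfer_exists p a : admissible p a ->
  exists (q : nat) (phi : R), [/\ (p < q)%N, 0 <= phi <= 1,
    phi * (a q - a p) = d p - a p, admissible p.+1 (transfer a p q)
    & contracting p a q phi].
Proof.
move=> ad; have ex := excess_stage ad; case: (ad) => ar an ai.
have s0 : 0 <= d p - a p by rewrite -ex.
have [tailmin|] :=
  pselect (forall n, (p < n)%N -> d p - a p <= excess a n).
  (* This threshold gives [a q - a p >= 2 * (d p - a p)], hence a quotient at most 1/2. *)
  have [K HK] := ai (d p + (d p - a p)).
  pose q := maxn K p.+1.
  have pq : (p < q)%N by rewrite leq_max leqnn orbT.
  have aq : d p + (d p - a p) <= a q by apply: HK; rewrite leq_max leqnn.
  exists q, ((d p - a p) / (a q - a p)).
  have adq : admissible p.+1 (transfer a p q).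
    by apply: transfer_admissible => // n /andP[pn _]; exact: tailmin.
  (* If [d p = a p] the denominator may vanish, but the numerator is 0 and so is the quotient. *)
  have [s_eq0|s_neq0] := eqVneq (d p - a p) 0.
    rewrite s_eq0 !mul0r; split=> //; first by rewrite lexx ler01.
    by left; lra.
  have sp : 0 < d p - a p by rewrite lt_neqAle eq_sym s_neq0.
  have gp : 0 < a q - a p by lra.
  have half : (d p - a p) / (a q - a p) <= 1 / 2 by rewrite ler_pdivrMr //; lra.
  split=> //; last by left.
  - by rewrite divr_ge0 ?(ltW gp) //=; lra.
  - by rewrite divfK // gt_eqF.
move=> /existsNP[n0 /not_implyP[pn0 /negP]]; rewrite -ltNge => en0.
have exP : exists n, (p < n)%N && (excess a n < d p - a p).
  by exists n0; rewrite pn0.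
case: (ex_minnP exP) => m /andP[pm em] mmin.
have pm1 : (p.+1 < m)%N.
  rewrite ltn_neqAle pm andbT; apply/eqP => E; move: em; rewrite -E ex; lra.
(* [excess a n] stops before index [n], so the drop at the first failing index [q.+1] is due to the
   term [q]. *)
case: m pm em mmin pm1 => // q pm em mmin; rewrite ltnS => pq.
have before n : (p < n <= q)%N -> d p - a p <= excess a n.
  move=> /andP[pn nq]; rewrite leNgt; apply/negP => en.
  by have := mmin n; rewrite pn en => /(_ isT); lia.
have aqd : d q < a q.
  have := before q; rewrite pq leqnn => /(_ isT).
  by move: em; rewrite /excess big_ord_recr /=; lra.
have dpq := d_mono (ltnW pq).
have sp : 0 < d p - a p by apply: le_lt_trans em.
have gp : 0 < a q - a p by lra.
exists q, ((d p - a p) / (a q - a p)); split=> //.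
- by rewrite divr_ge0 ?(ltW gp) //= ler_pdivrMr //; lra.
- by rewrite divfK // gt_eqF.
- exact: transfer_admissible.
(* Since [d q < a q], the denominator [a q - a p] exceeds [(d p - a p) + (d q - d p)]. *)
right; split=> //; rewrite mulrAC ler_pdivrMr //.
by apply: ler_wpM2l => //; lra.
Qed.

End Transfer.

(** * Decay of a weight carried along [r, q r, q (q r), ...] *)

Section Decay.
Variables (R : realType) (d s phi : nat -> R) (q : nat -> nat).
Hypotheses (d_mono : nondecreasing_seq d) (d_infty : to_infty d).
Hypotheses (q_gt : forall r, (r < q r)%N) (phi01 : forall r, 0 <= phi r <= 1).
Hypothesis step : forall r, phi r <= 1 / 2 \/
  [/\ 0 < s r, s (q r) <= s r & phi r * (s r + (d (q r) - d r)) <= s r].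
Variable P : nat -> R -> Prop.
Hypothesis P_step : forall r w, 0 <= w -> P r w -> P (q r) (phi r * w).

Lemma weight_halves r w : 0 <= w -> P r w ->
  exists r' w', [/\ 0 <= w', w' <= w / 2 & P r' w'].
Proof.
move=> w0 Prw; apply: contrapT => none.
(* along a path that is never halved the weight keeps below
   [w s / (s + (d_n - d_r))], and [d] is unbounded *)
have run n : exists r' w', [/\ (n + r <= r')%N, 0 <= w', P r' w',
    w' * (s r + (d r' - d r)) <= w * s r & s r' <= s r /\ w' <= w].
  elim: n => [|n [r' [w' [nr w'0 Pr' bnd [sr ww]]]]].
    by exists r, w; split=> //; rewrite subrr addr0.
  have [p0 p1] := andP (phi01 r').
  have Pn := P_step w'0 Pr'.
  have pw0 : 0 <= phi r' * w' by rewrite mulr_ge0.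
  case: (step r') => [h|[sp sq ph]].
    exfalso; apply: none; exists (q r'), (phi r' * w'); split=> //.
    have := ler_pM p0 w'0 h ww; lra.
  have pw : phi r' * w' <= w' by rewrite ler_piMl.
  exists (q r'), (phi r' * w'); split=> //; last by split; lra.
    by rewrite addSn; apply: leq_ltn_trans (q_gt r').
  have dq := d_mono (ltnW (q_gt r')).
  have dr : d r <= d r' by apply/d_mono/(leq_trans _ nr); rewrite leq_addl.
  have srp : 0 < s r by lra.
  set g := d (q r') - d r' in ph *.
  have g0 : 0 <= g by rewrite subr_ge0.
  (* [s/(s+G) * s/(s+g) <= s/(s+G+g)] *)
  have ph2 : phi r' * (s r + g) <= s r.
    (* [x / (x + g)] increases with [x], so [s r'] may be replaced by the larger [s r]. *)
    have : phi r' * (s r - s r') <= 1 * (s r - s r').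
      by apply: ler_wpM2r => //; lra.
    lra.
  have key : (phi r' * w') * (s r + (d r' - d r)) * (s r + g)
      <= (w * s r) * s r.
    have -> : phi r' * w' * (s r + (d r' - d r)) * (s r + g) =
      w' * (s r + (d r' - d r)) * (phi r' * (s r + g)) by ring.
    apply: ler_pM => //; first by apply: mulr_ge0 => //; lra.
    by apply: mulr_ge0 => //; lra.
  rewrite -(ler_pM2r srp); apply: le_trans key.
  rewrite -!mulrA ler_wpM2l // ler_wpM2l //.
  have -> : d (q r') - d r = d r' - d r + g by rewrite /g; ring.
  have : 0 <= (d r' - d r) * g by apply: mulr_ge0; lra.
  nra.
(* Either the first step already halves the weight, or [s r > 0] and one may divide by it. *)
case: (step r) => [h|[sp _ _]].
  apply: none; exists (q r), (phi r * w).
  have [p0 p1] := andP (phi01 r).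
  split; [by rewrite mulr_ge0| |exact: P_step].
  by rewrite mulrC; apply: ler_wpM2l => //; lra.
(* Past [K] the factor [s r / (s r + (d r' - d r))] is at most 1/2. *)
have [K HK] := d_infty (d r + s r).
have [r' [w' [nr w'0 Pr' bnd [sr ww]]]] := run K.
apply: none; exists r', w'; split=> //.
have dr := HK r' (leq_trans (leq_addr _ _) nr).
rewrite -(ler_pM2r sp).
have : w' * (s r + s r) <= w' * (s r + (d r' - d r)).
  by apply: ler_wpM2l => //; lra.
lra.
Qed.

Lemma weight_vanishes r w eps : 0 <= w -> P r w -> 0 < eps ->
  exists r' w', [/\ 0 <= w', w' < eps & P r' w'].
Proof.
move=> w0 Prw e0.
(* After [n] halvings the bound [w / (n + 1)] is enough; it propagates because
   [(n + 2) / 2 <= n + 1]. *)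
have H n : exists r' w', [/\ 0 <= w', w' * n.+1%:R <= w & P r' w'].
  elim: n => [|n [r' [w' [w'0 wn Pr']]]]; first by exists r, w; rewrite mulr1.
  have [r2 [w2 [w20 ww P2]]] := weight_halves w'0 Pr'.
  exists r2, w2; split=> //; apply: le_trans wn.
  apply: (@le_trans _ _ (w' / 2 * n.+2%:R)); first exact: ler_wpM2r.
  rewrite -mulrA ler_wpM2l // mulrC ler_pdivrMr // -natrM ler_nat; lia.
have [n wn] : exists n, w / eps < n.+1%:R.
  exists (Num.bound (w / eps)).
  have := archi_boundP (divr_ge0 w0 (ltW e0)); rewrite -natr1; lra.
have [r' [w' [w'0 wn' Pr']]] := H n.
exists r', w'; split=> //.
rewrite -(@ltr_pM2r _ n.+1%:R) ?ltr0n //; apply: le_lt_trans wn' _.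
by rewrite mulrC -ltr_pdivrMr.
Qed.

End Decay.

(** * Linear spans *)

Section Span.
Variables (R : realType) (H : lmodType R[i]).
Implicit Types (f : nat -> H) (W : H -> Prop).

Lemma subspaceD W x y : linear_subspace W -> W x -> W y -> W (x + y).
Proof. by move=> [_ WL] Wx Wy; rewrite -[x]scale1r; apply: WL. Qed.

Lemma subspaceZ W a x : linear_subspace W -> W x -> W (a *: x).
Proof. by move=> [W0 WL] Wx; rewrite -[_ *: _]addr0; apply: WL. Qed.

Lemma lin_span_min W f x :
  linear_subspace W -> (forall k, W (f k)) -> lin_span f x -> W x.
Proof.
move=> Ws Wf [n [c ->]]; elim: n => [|n IH]; first by rewrite big_ord0; case: Ws.
by rewrite big_ord_recr; apply: subspaceD => //; apply: subspaceZ.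
Qed.

Lemma lin_span_gen f k : lin_span f (f k).
Proof.
exists k.+1, (fun i => (i == k)%:R).
rewrite big_ord_recr /= eqxx scale1r big1 ?add0r // => i _.
by rewrite (ltn_eqF (ltn_ord i)) scale0r.
Qed.

Lemma lin_span_subspace f : linear_subspace (lin_span f).
Proof.
split; first by exists 0%N, (fun=> 0); rewrite big_ord0.
(* Coefficients are padded with zeros to bring two combinations to a common length. *)
have widen n m (c : nat -> R[i]) : (n <= m)%N ->
    \sum_(k < n) c k *: f k = \sum_(k < m) (if (k < n)%N then c k else 0) *: f k.
  move=> nm; rewrite (big_ord_widen m (fun k => c k *: f k)) // big_mkcond.
  by apply: eq_bigr => k _; case: ifP; rewrite ?scale0r.
move=> a x y [n [c ->]] [m [c' ->]]; exists (maxn n m).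
exists (fun k => a * (if (k < n)%N then c k else 0) +
                 (if (k < m)%N then c' k else 0)).
rewrite (widen n (maxn n m)) ?leq_maxl // (widen m (maxn n m)) ?leq_maxr //.
rewrite scaler_sumr -big_split; apply: eq_bigr => k _ /=.
by rewrite scalerA scalerDl.
Qed.

End Span.

(** * Inner products, squared norms and closures *)

Section Hilbert.
Variables (R : realType) (H : lmodType R[i]) (ip : H -> H -> R[i]).
Hypothesis hs : hilbert_space ip.

Lemma ipDl x y z : ip (x + y) z = ip x z + ip y z.
Proof. by rewrite -[x]scale1r (ip_linl hs) mul1r scale1r. Qed.

Lemma ip0l z : ip 0 z = 0.
Proof. by have := ipDl 0 0 z; rewrite addr0 -{1}[ip 0 z]addr0 => /addrI. Qed.

Lemma ipZl a x z : ip (a *: x) z = a * ip x z.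
Proof. by have := ip_linl hs a x 0 z; rewrite ip0l !addr0. Qed.

Lemma ipDr x y z : ip x (y + z) = ip x y + ip x z.
Proof. by rewrite (ip_herm hs) ipDl rmorphD /= -!(ip_herm hs). Qed.

Lemma ipZr a x z : ip x (a *: z) = a^* * ip x z.
Proof. by rewrite (ip_herm hs) ipZl rmorphM /= -!(ip_herm hs). Qed.

Definition sqnorm (x : H) : R := complex.Re (ip x x).
Definition csq (z : R[i]) : R := complex.Re z ^+ 2 + complex.Im z ^+ 2.

Lemma csq_ge0 z : 0 <= csq z.
Proof. by rewrite addr_ge0 // sqr_ge0. Qed.

Lemma csqM y z : csq (y * z) = csq y * csq z.
Proof. by case: y => a b; case: z => c e; rewrite /csq /=; ring. Qed.

Lemma mul_conjC_csq z : z * z^* = (csq z)%:C.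
Proof. by rewrite -normCK -add_Re2_Im2. Qed.

Lemma sqnormE x : ip x x = (sqnorm x)%:C.
Proof. by rewrite RRe_real // ger0_real // (ip_pos hs). Qed.

Lemma sqnorm_ge0 x : 0 <= sqnorm x.
Proof. by rewrite -ler0c -sqnormE (ip_pos hs). Qed.

Lemma sqnormZ a x : sqnorm (a *: x) = csq a * sqnorm x.
Proof.
apply: complexI; rewrite -sqnormE ipZl ipZr mulrA mul_conjC_csq sqnormE.
by rewrite -rmorphM.
Qed.

(* parallelogram law *)
Lemma sqnormD_le x y : sqnorm (x + y) <= 2 * sqnorm x + 2 * sqnorm y.
Proof.
suff : sqnorm (x + y) + sqnorm (x + (-1) *: y) = 2 * sqnorm x + 2 * sqnorm y.
  by have := sqnorm_ge0 (x + (-1) *: y); lra.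
apply: complexI; rewrite !rmorphD /= !rmorphM /= -!sqnormE.
rewrite !(ipDl, ipDr, ipZl, ipZr) rmorphN rmorph1 (rmorph_nat _ 2); ring.
Qed.

(** With squared norms, [sqnormD_le] can stand in for the triangle inequality. *)
Lemma hclosureP (A : H -> Prop) h : hclosure ip A h <->
  forall e : R, 0 < e -> exists g, A g /\ sqnorm (h - g) < e.
Proof.
split=> HA e e0.
  have se : 0 < Num.sqrt e by rewrite sqrtr_gt0.
  have [g [Ag ng]] := HA _ se; exists g; split=> //.
  by move: ng; rewrite /hnorm ltr_sqrt.
have e2 : 0 < e ^+ 2 by rewrite exprn_gt0.
have [g [Ag ng]] := HA _ e2; exists g; split=> //.
by rewrite /hnorm -(@gtr0_norm _ e) // -sqrtr_sqr ltr_sqrt.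
Qed.

Lemma hclosure_subspace A :
  linear_subspace A -> linear_subspace (hclosure ip A).
Proof.
move=> As; have [A0 AL] := As; split.
  apply/hclosureP => e e0; exists 0; split=> //.
  by rewrite subr0 /sqnorm ip0l.
move=> a x y /hclosureP Hx /hclosureP Hy; apply/hclosureP => e e0.
have ca := csq_ge0 a.
(* Each of the two terms of [sqnormD_le] gets [e / 2]; adding 1 to [csq a] covers [a = 0]. *)
have e1 : 0 < e / 4 / (1 + csq a) by rewrite !divr_gt0 //; lra.
have e4 : 0 < e / 4 by rewrite divr_gt0.
have [g [Ag ng]] := Hx _ e1; have [k [Ak nk]] := Hy _ e4.
exists (a *: g + k); split; first exact: AL.
have -> : a *: x + y - (a *: g + k) = a *: (x - g) + (y - k).
  by rewrite scalerBr opprD addrACA.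
apply: le_lt_trans (sqnormD_le _ _) _; rewrite sqnormZ.
move: ng; rewrite ltr_pdivlMr; last by lra.
have := sqnorm_ge0 (x - g); lra.
Qed.

Lemma hclosure_sub A B :
  (forall x, A x -> hclosure ip B x) ->
  forall x, hclosure ip A x -> hclosure ip B x.
Proof.
move=> AB x /hclosureP Ax; apply/hclosureP => e e0.
have e4 : 0 < e / 4 by rewrite divr_gt0.
have [g [Ag ng]] := Ax _ e4; have /hclosureP/(_ _ e4)[k [Bk nk]] := AB _ Ag.
exists k; split=> //; have -> : x - k = (x - g) + (g - k) by rewrite addrA subrK.
apply: le_lt_trans (sqnormD_le _ _) _; lra.
Qed.

(** * Rotations in a plane and the quadratic form of a symmetric operator *)

Section Rotation.
Variables (D : H -> Prop) (E : H -> H).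
Hypotheses (Dsub : linear_subspace D) (El : linear_on D E).
Hypothesis Esym : symmetric_on ip D E.

Lemma linear_on_comb a b x y : D x -> D y ->
  E (a *: x + b *: y) = a *: E x + b *: E y.
Proof.
move=> Dx Dy; have [D0 _] := Dsub.
have E0 : E 0 = 0.
  by have := El (-1) D0 D0; rewrite scaler0 addr0 scaleN1r addNr.
have EZ : E (b *: y) = b *: E y by have := El b Dy D0; rewrite E0 !addr0.
by rewrite El ?EZ //; apply: subspaceZ.
Qed.

(** Symmetry of [E] makes the two cross terms complex conjugates of each other. *)
Lemma quad_form_comb a b x y : D x -> D y ->
  ip (E (a *: x + b *: y)) (a *: x + b *: y) =
  (csq a)%:C * ip (E x) x + (csq b)%:C * ip (E y) y +
  (a * b^* * ip (E x) y + (a * b^* * ip (E x) y)^*).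
Proof.
move=> Dx Dy; rewrite linear_on_comb // !(ipDl, ipDr, ipZl, ipZr).
have -> : ip (E y) x = (ip (E x) y)^* by rewrite Esym // -(ip_herm hs).
by rewrite !rmorphM /= conjCK -!mul_conjC_csq; ring.
Qed.

(* The phase of [b] is chosen so that the cross term is purely imaginary. *)
Lemma phase_exists (z : R[i]) (phi : R) : 0 <= phi <= 1 ->
  exists a b : R[i], [/\ csq a = 1 - phi, csq b = phi
    & a * b^* * z + (a * b^* * z)^* = 0].
Proof.
move=> /andP[p0 p1].
have [zeta [zeta1 zetaz]] : exists zeta : R[i],
    csq zeta = 1 /\ zeta^* * z + (zeta^* * z)^* = 0.
  have [->|z0] := eqVneq z 0.
    by exists 1; rewrite mulr0 rmorph0 addr0 /csq /= expr1n expr0n addr0.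
  have nz : `|z| != 0 by rewrite normr_eq0.
  have zz : z * z^* = `|z| ^+ 2 by rewrite normCK.
  have nr : (`|z|)^* = `|z| by rewrite conj_Creal // normr_real.
  (* With this phase [zeta^* * z] equals [- 'i] times the modulus of [z]. *)
  exists ('i * z / `|z|); split.
    apply: complexI; rewrite -mul_conjC_csq !rmorphM /= fmorphV /= nr.
    rewrite conjCi; transitivity (- 'i ^+ 2 * (z * z^*) / `|z| ^+ 2).
      by field.
    by rewrite sqrCi zz opprK mul1r divff // expf_neq0.
  by rewrite !rmorphM /= !fmorphV /= !conjCK nr conjCi; field.
exists (Num.sqrt (1 - phi))%:C, ((Num.sqrt phi)%:C * zeta).
have csqr (t : R) : 0 <= t -> csq (Num.sqrt t)%:C = t.
  by move=> t0; rewrite /csq /= expr0n addr0 sqr_sqrtr.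
have cr (t : R) : (t%:C)^* = t%:C := conjc_real t.
split; rewrite ?csqM ?csqr ?zeta1 ?mulr1 //; first by lra.
rewrite !rmorphM /= !cr conjCK; move: zetaz; rewrite rmorphM /= conjCK => zz.
set s := (Num.sqrt _)%:C; set t := (Num.sqrt _)%:C.
transitivity (s * t * (zeta^* * z + zeta * z^*)); first by ring.
by rewrite zz mulr0.
Qed.

(** One phase choice kills the cross term for both new vectors. The inverse coefficients track mass:
    [csq c2] is the share of [u] left outside [x], and [csq c4 <= 1] says that what sits at [v] does
    not grow. *)
Lemma rotation u v (a b phi : R) : D u -> D v ->
  ip u u = 1 -> ip v v = 1 -> ip u v = 0 ->
  ip (E u) u = a%:C -> ip (E v) v = b%:C -> 0 <= phi <= 1 ->
  exists x y, [/\ [/\ ip x x = 1, ip y y = 1 & ip x y = 0],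
    ip (E x) x = (a + phi * (b - a))%:C,
    ip (E y) y = (b - phi * (b - a))%:C,
    exists c1 c2 c3 c4, x = c1 *: u + c2 *: v /\ y = c3 *: u + c4 *: v
    & exists c1 c2 c3 c4, [/\ u = c1 *: x + c2 *: y, v = c3 *: x + c4 *: y,
        csq c2 = phi & csq c4 <= 1]].
Proof.
move=> Du Dv uu vv uv Eu Ev p01; have [p0 p1] := andP p01.
have vu : ip v u = 0 by rewrite (ip_herm hs) uv rmorph0.
have [al [be [sal sbe cross]]] := phase_exists (ip (E u) v) p01.
have csqJ z : csq z^* = csq z by case: z => ? ?; rewrite /csq /= sqrrN.
have csqN z : csq (- z) = csq z by case: z => ? ?; rewrite /csq /= !sqrrN.
have unit : al * al^* + be * be^* = 1.
  by rewrite !mul_conjC_csq sal sbe -rmorphD /= subrK.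
exists (al *: u + be *: v), (- be^* *: u + al^* *: v); split.
- rewrite !(ipDl, ipDr, ipZl, ipZr) uu vv uv vu rmorphN /= !conjCK.
  rewrite !(mulr1, mulr0, addr0, add0r).
  by split; [rewrite -unit; ring|rewrite -unit; ring|ring].
- rewrite quad_form_comb // Eu Ev cross addr0 sal sbe -!rmorphM -rmorphD.
  by congr (_%:C); ring.
- rewrite quad_form_comb // Eu Ev csqN !csqJ sal sbe.
  have -> : - be^* * (al^*)^* * ip (E u) v = - (al * be^* * ip (E u) v).
    by rewrite conjCK; ring.
  rewrite rmorphN -opprD cross oppr0 addr0 -!rmorphM -rmorphD.
  by congr (_%:C); ring.
- by exists al, be, (- be^*), (al^*).
(* The change of basis is unitary, so its inverse is its adjoint. *)
exists (al^*), (- be), (be^*), al.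
rewrite csqN sbe sal !scalerDr !scalerA; split=> //; last by lra.
  rewrite addrACA -!scalerDl.
  have -> : al^* * al + - be * - be^* = 1 by rewrite -unit; ring.
  have -> : al^* * be + - be * al^* = 0 by ring.
  by rewrite scale1r scale0r addr0.
rewrite addrACA -!scalerDl.
have -> : be^* * be + al * al^* = 1 by rewrite -unit; ring.
have -> : be^* * al + al * - be^* = 0 by ring.
by rewrite scale1r scale0r add0r.
Qed.

End Rotation.
End Hilbert.

(** * Iterated rotations and the limiting sequence *)

Section Construction.
Variables (R : realType) (H : lmodType R[i]) (ip : H -> H -> R[i]).
Hypothesis hs : hilbert_space ip.
Variables (D : H -> Prop) (E : H -> H).
Hypotheses (Dsub : linear_subspace D) (El : linear_on D E).
Hypothesis Esym : symmetric_on ip D E.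
Variables (d : nat -> R) (f : nat -> H).
Hypotheses (d_mono : nondecreasing_seq d) (Df : forall i, D (f i)).

Definition stage p (a : nat -> R) (G : nat -> H) :=
  [/\ admissible d p a, orthonormal_seq ip G, forall k, lin_span f (G k)
    & forall k, ip (E (G k)) (G k) = (a k)%:C].

Definition stage_step p a (G : nat -> H) q phi a' (G' : nat -> H) :=
  [/\ [/\ (p < q)%N, 0 <= phi <= 1 & contracting d p a q phi],
      forall n, excess d a' n <= excess d a n,
      forall k, k != p -> k != q -> G' k = G k
    & exists c1 c2 c3 c4, [/\ G p = c1 *: G' p + c2 *: G' q,
        G q = c3 *: G' p + c4 *: G' q, csq c2 = phi & csq c4 <= 1]].

Lemma stage_step_exists p a G : stage p a G ->
  exists q phi a' G', stage p.+1 a' G' /\ stage_step p a G q phi a' G'.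
Proof.
move=> [ad on sp va].
have [q [phi [pq p01 phiE ad' ctr]]] := transfer_exists d_mono ad.
have DG k : D (G k) by apply: lin_span_min Dsub Df (sp k).
have qp : (q == p) = false by rewrite gtn_eqF.
have o1 k : ip (G k) (G k) = 1 by rewrite on eqxx.
have o0 i j : i != j -> ip (G i) (G j) = 0 by rewrite on => /negbTE->.
have opq : ip (G p) (G q) = 0 by rewrite o0 // eq_sym qp.
have [x [y [[xx yy xy] Ex Ey]]] :=
  rotation hs Dsub El Esym (DG p) (DG q) (o1 p) (o1 q) opq (va p) (va q) p01.
move=> [c1 [c2 [c3 [c4 [xE yE]]]]] [b1 [b2 [b3 [b4 [uE vE sb2 sb4]]]]].
have spL a1 a2 : lin_span f (a1 *: G p + a2 *: G q).
  have [_ L] := lin_span_subspace f.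
  by apply: L => //; apply: subspaceZ => //; exact: lin_span_subspace.
pose G' k := if k == p then x else if k == q then y else G k.
have G'p : G' p = x by rewrite /G' eqxx.
have G'q : G' q = y by rewrite /G' qp eqxx.
exists q, phi, (transfer d a p q), G'; split; last first.
  split=> //.
  - by move=> n; exact: excess_transfer_le.
  - by move=> k /negbTE kp /negbTE kq; rewrite /G' kp kq.
  - by exists b1, b2, b3, b4; rewrite G'p G'q.
split=> //.
- have yx : ip y x = 0 by rewrite (ip_herm hs) xy rmorph0.
  have ort k a1 a2 : k != p -> k != q ->
      ip (a1 *: G p + a2 *: G q) (G k) = 0 /\
      ip (G k) (a1 *: G p + a2 *: G q) = 0.
    move=> kp kq; rewrite !(ipDl hs, ipDr hs, ipZl hs, ipZr hs).
    have [pk qk] : p != k /\ q != k by rewrite ![_ == k]eq_sym.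
    by rewrite !o0 // !mulr0 addr0.
  move=> i j; rewrite /G'.
  have [/eqP->|ip'] := boolP (i == p).
    have [/eqP->|jp] := boolP (j == p); first by rewrite eqxx.
    have [/eqP->|jq] := boolP (j == q); first by rewrite eq_sym qp.
    by rewrite eq_sym (negbTE jp) xE; case: (ort j c1 c2 jp jq).
  have [/eqP->|iq] := boolP (i == q).
    have [/eqP->|jp] := boolP (j == p); first by rewrite qp.
    have [/eqP->|jq] := boolP (j == q); first by rewrite eqxx.
    by rewrite eq_sym (negbTE jq) yE; case: (ort j c3 c4 jp jq).
  have [/eqP->|jp] := boolP (j == p).
    by rewrite (negbTE ip') xE; case: (ort i c1 c2 ip' iq).
  have [/eqP->|jq] := boolP (j == q); last exact: on.
  by rewrite (negbTE iq) yE; case: (ort i c3 c4 ip' iq).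
- by move=> k; rewrite /G'; case: ifP => _; [rewrite xE|case: ifP => // _; rewrite yE].
(* [phiE] turns the values [a p + phi * (a q - a p)] and [a q - phi * (a q - a p)] into those of the
   transfer. *)
- move=> k; rewrite /G' /transfer; case: eqVneq => [->|kp].
    by rewrite eq_sym qp Ex phiE /=; congr (_%:C); ring.
  case: eqVneq => [->|kq]; last by rewrite va /=; congr (_%:C); ring.
  by rewrite Ey phiE /=; congr (_%:C); ring.
Qed.

Variables (lam : nat -> R).
Hypotheses (lam_infty : to_infty lam) (d_infty : to_infty d).
Hypothesis lam_le : forall n, \sum_(i < n) lam i <= \sum_(i < n) d i.
Hypotheses (f_on : orthonormal_seq ip f)
  (f_val : forall i, ip (E (f i)) (f i) = (lam i)%:C).

Lemma stages_exist : exists (q : nat -> nat) (phi : nat -> R)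
    (a : nat -> nat -> R) (G : nat -> nat -> H),
  [/\ G 0%N = f, forall p, stage p (a p) (G p)
    & forall p, stage_step p (a p) (G p) (q p) (phi p) (a p.+1) (G p.+1)].
Proof.
pose S : Type := (nat -> R) * (nat -> H).
have next (x : nat * S) : exists y : nat * R * S,
    stage x.1 x.2.1 x.2.2 -> stage x.1.+1 y.2.1 y.2.2 /\
      stage_step x.1 x.2.1 x.2.2 y.1.1 y.1.2 y.2.1 y.2.2.
  have [st|nst] := pselect (stage x.1 x.2.1 x.2.2); last first.
    (* An arbitrary value off the stages makes the relation total, as [choice] requires. *)
    by exists (0%N, 0, x.2) => /nst.
  have [q [phi [a' [G' st']]]] := stage_step_exists st.
  by exists (q, phi, (a', G')).
have [F HF] := choice next.
pose fix X p : S := if p is p'.+1 then (F (p', X p')).2 else (lam, f).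
have stX p : stage p (X p).1 (X p).2.
  elim: p => [|p IH]; last by case: (HF (p, X p) IH).
  split=> //; last by move=> k; exact: lin_span_gen.
  (* At stage 0, nonnegative excesses are the hypothesis on partial sums. *)
  by split=> // n; rewrite /excess sumrB subr_ge0.
exists (fun p => (F (p, X p)).1.1), (fun p => (F (p, X p)).1.2),
  (fun p => (X p).1), (fun p => (X p).2); split=> // p.
by case: (HF (p, X p) (stX p)).
Qed.

Lemma schur_horn_sequence : exists e : nat -> H,
  [/\ orthonormal_seq ip e, forall i, lin_span f (e i),
    forall j, hclosure ip (lin_span e) (f j)
    & forall i, ip (E (e i)) (e i) = (d i)%:C].
Proof.
have [q [phi [a [G [G0 st stp]]]]] := stages_exist.
have qgt p : (p < q p)%N by case: (stp p) => [[]].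
have Gstep p r : (r < p)%N -> G p.+1 r = G p r.
  move=> rp; case: (stp p) => _ _ Gs _.
  by apply: Gs; rewrite ltn_eqF // (ltn_trans rp).
(* Step [p] fixes position [p] for good: later steps only touch larger positions. *)
pose e p := G p.+1 p.
have Ge p r : (r < p)%N -> G p r = e r.
  elim: p => // p IH; rewrite ltnS leq_eqVlt => /orP[/eqP->//|rp].
  by rewrite Gstep // IH.
exists e; split.
- move=> i j; pose m := (maxn i j).+1.
  have [_ on _ _] := st m; rewrite -(on i j) !Ge // ltnS ?leq_maxl ?leq_maxr //.
- by move=> i; have [_ _ sp _] := st i.+1; exact: sp.
- move=> j.
  have [_ eL] := lin_span_subspace e.
  (* by stage [s <= r] all of [f j] but a vector of squared norm at most [w]
     along [G s r] is in the span of [e] *)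
  pose T s r w := exists y rho,
    [/\ lin_span e y, f j = y + rho *: G s r & csq rho <= w].
  (* Before its turn, position [r] changes only when [r = q s]; then part of the residual joins the
     span and the rest is scaled by [c4]. *)
  have wait s r w : (s < r)%N -> T s r w -> T s.+1 r w.
    move=> sr [y [rho [Ly fE le]]].
    have [_ _ Gs [c1 [c2 [c3 [c4 [_ qE _ c41]]]]]] := stp s.
    have [rq|rq] := eqVneq r (q s); last first.
      by exists y, rho; split=> //; rewrite Gs // gtn_eqF.
    exists (rho * c3 *: e s + y), (rho * c4); split.
    + by apply: eL => //; exact: lin_span_gen.
    + rewrite fE rq qE scalerDr !scalerA addrA; congr (_ + _); exact: addrC.
    + by rewrite csqM; apply: le_trans le; rewrite ler_piMr // csq_ge0.
  have waits r w n s : (s + n)%N = r -> T s r w -> T r r w.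
    elim: n s => [|n IH] s; first by rewrite addn0 => ->.
    move=> snr Ts; apply: (IH s.+1); first by rewrite addSnnS.
    by apply: wait => //; rewrite -snr addnS ltnS leq_addr.
  (* Step [r] sends the fraction [phi r] of the residual to position [q r], where it waits for stage
     [q r]. *)
  have move_on r w : 0 <= w -> T r r w -> T (q r) (q r) (phi r * w).
    move=> w0 [y [rho [Ly fE le]]].
    have [_ _ Gs [c1 [c2 [c3 [c4 [pE _ c2E _]]]]]] := stp r.
    apply: (waits (q r) (phi r * w) (q r - r.+1)%N r.+1 (subnKC (qgt r))).
    exists (rho * c1 *: e r + y), (rho * c2); split.
    + by apply: eL => //; exact: lin_span_gen.
    + rewrite fE pE scalerDr !scalerA addrA; congr (_ + _); exact: addrC.
    + rewrite csqM c2E mulrC; apply: ler_wpM2l => //.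
      by rewrite -c2E csq_ge0.
  have Tj : T j j 1.
    apply: (waits j 1 j 0%N (add0n j)); exists 0, 1; rewrite G0 add0r scale1r.
    split=> //; first by case: (lin_span_subspace e).
    by rewrite /csq /= expr1n expr0n addr0.
  have phi01 p : 0 <= phi p <= 1 by case: (stp p) => [[]].
  pose s r := d r - a r r.
  have excess_mono r n k : excess d (a (r + k)%N) n <= excess d (a r) n.
    elim: k => [|k IH]; first by rewrite addn0.
    by apply: le_trans IH; rewrite addnS; have [_ le _ _] := stp (r + k)%N; exact: le.
  have ctr r : phi r <= 1 / 2 \/
      [/\ 0 < s r, s (q r) <= s r & phi r * (s r + (d (q r) - d r)) <= s r].
    have [[_ _ [h|[s0 ex ph]]] _ _ _] := stp r; first by left.
    right; split=> //; apply: le_trans (ltW ex).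
    have [ad _ _ _] := st (q r).
    (* [s (q r)] is the excess of index [(q r).+1] at stage [q r], bounded by the one at stage
       [r]. *)
    rewrite /s -(excess_stage ad).
    by have := excess_mono r (q r).+1 (q r - r)%N; rewrite subnKC // ltnW.
  apply/hclosureP => eps eps0.
  have [r [w [w0 we [y [rho [Ly fE le]]]]]] :=
    @weight_vanishes _ d s phi q d_mono d_infty qgt phi01 ctr
      (fun r w => T r r w) move_on j 1 eps ler01 Tj eps0.
  exists y; split=> //; rewrite fE addrC addKr (sqnormZ hs).
  have [_ on _ _] := st r; rewrite /sqnorm on eqxx mulr1.
  exact: le_lt_trans we.
- move=> i; have [[ai _ _] _ _ va] := st i.+1.
  by rewrite va ai.
Qed.

End Construction.

(** * Equality of the closed spans *)

Theorem theorem2p1 (R : realType) (H : lmodType R[i]) (ip : H -> H -> R[i])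
  (D : H -> Prop) (E : H -> H) (d lam : nat -> R) (f : nat -> H) :
  hilbert_space ip ->
  linear_subspace D -> dense_in ip D ->
  linear_on D E -> symmetric_on ip D E ->
  nondecreasing_seq d -> unbounded_seq d ->
  nondecreasing_seq lam -> unbounded_seq lam ->
  (forall n : nat, \sum_(i < n) lam i <= \sum_(i < n) d i) ->
  (forall i, D (f i)) -> orthonormal_seq ip f ->
  (forall i, ip (E (f i)) (f i) = (lam i)%:C) ->
  exists e : nat -> H,
    orthonormal_seq ip e /\
    (forall i, lin_span f (e i)) /\
    (forall h, hclosure ip (lin_span e) h <-> hclosure ip (lin_span f) h) /\
    (forall i, ip (E (e i)) (e i) = (d i)%:C).
Proof.
move=> hs Dsub _ El Esym d_mono d_unb lam_mono lam_unb lam_le Df f_on f_val.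
have [e [e_on ef fe e_val]] := schur_horn_sequence hs Dsub El Esym d_mono Df
  (to_infty_mono lam_mono lam_unb) (to_infty_mono d_mono d_unb) lam_le f_on f_val.
exists e; split=> //; split=> //; split=> // h; split.
- apply: hclosure_sub => // x ex; apply/hclosureP => eps eps0.
  exists x; split; last by rewrite subrr /sqnorm ip0l.
  exact: lin_span_min (lin_span_subspace f) ef ex.
(* The closed span of [e] is a subspace containing every [f j]. *)
- apply: hclosure_sub => // x; apply: lin_span_min => //.
  exact/hclosure_subspace/lin_span_subspace.
Qed.
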